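(* Let $k$ be an algebraically closed field of characteristic zero and let $q\in k$ with $q^i\neq1$ for every nonzero integer $i$. Let $f\in k(t,x)$ be such that, over the algebraic closure $\overline{k(t)}$ of $k(t)$, $$f=\sum_{i=1}^m\sum_{j=1}^{n_i}\frac{\alpha_{i,j}}{(x-\beta_i)^j},$$ where $\alpha_{i,j},\beta_i\in\overline{k(t)}$, $\alpha_{i,n_i}\neq 0$ for each $i$, and $\beta_i-\beta_{i'}\notin\mathbb{Z}$ for $i\neq i'$. Then there exist a nonzero operator $L\in k(t)\langle Q_t\rangle$ and $g\in k(t,x)$ with $L(f)=\Delta_x(g)$ if and only if all the $\beta_i$ lie in $k$.
   Context: $Q_t(h(t,x))=h(qt,x)$; $S_x(h(t,x))=h(t,x+1)$ and $\Delta_x=S_x-1$. $k(t)\langle Q_t\rangle$ is the ring of operators $\sum_\ell e_\ell Q_t^\ell$ with $e_\ell\in k(t)$, acting on $k(t,x)$. *)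

(* Defs.v *)
From HB Require Import structures.
From mathcomp Require Import all_boot all_order all_algebra.
From mathcomp Require Import fraction.

Set Implicit Arguments.
Unset Strict Implicit.
Unset Printing Implicit Defensive.

Import GRing.Theory.
Local Open Scope ring_scope.
Local Open Scope quotient_scope.

Notation "x %:F" := (@FracField.tofrac _ x) : ring_scope.

(* k(t), and k(t, x) presented as k(t)(x). *)
Notation ratfun k := {fraction {poly k}}.
Notation ratfun2 k := {fraction {poly {fraction {poly k}}}}.

(* The extension of phi to fraction fields.  Computing it on the chosen
   representative of a fraction is only meaningful when phi is an injective
   ring morphism; see frac_mapE and the two lemmas after it. *)
Definition frac_map (A B : idomainType) (phi : A -> B) (u : {fraction A}) :
    {fraction B} :=
  (phi \n_(repr u))%:F / (phi \d_(repr u))%:F.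

Section FracMapTheory.
Variables (A B : idomainType) (phi : {rmorphism A -> B}).
Hypothesis phi_inj : injective phi.

Lemma frac_repr (u : {fraction A}) :
  u = (\n_(repr u))%:F / (\d_(repr u))%:F.
Proof.
have dn0 := denom_ratioP (repr u).
apply: (canRL (mulfK _)); first by rewrite tofrac_eq0.
rewrite -[X in X * _ = _]reprK; move: (repr u) dn0 => r dn0.
unlock FracField.tofrac; rewrite -[LHS]FracField.pi_mul; apply/eqmodP.
rewrite /= FracField.equivfE /FracField.mulf.
by rewrite !numden_Ratio ?mulf_neq0 ?oner_neq0 // !mulr1 mulrC.
Qed.

Lemma frac_mapE (n d : A) :
  d != 0 -> frac_map phi (n%:F / d%:F) = (phi n)%:F / (phi d)%:F.
Proof.
move=> dn0; rewrite /frac_map; set u := n%:F / d%:F.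
have un0 := denom_ratioP (repr u).
have phi0 a : a != 0 -> (phi a)%:F != 0.
  by move=> an0; rewrite tofrac_eq0 -(rmorph0 phi) (inj_eq phi_inj).
have /eqP := frac_repr u; rewrite {1}/u eqr_div ?tofrac_eq0 //.
rewrite -!tofracM tofrac_eq => /eqP E.
apply/eqP; rewrite eqr_div ?phi0 // -!tofracM tofrac_eq -!rmorphM.
by rewrite E.
Qed.

Lemma frac_map_tofrac a : frac_map phi a%:F = (phi a)%:F.
Proof.
by rewrite -[a%:F]divr1 -tofrac1 frac_mapE ?oner_neq0 // rmorph1 tofrac1 divr1.
Qed.

Lemma frac_map_is_zmod_morphism : zmod_morphism (frac_map phi).
Proof.
move=> u v; rewrite (frac_repr u) (frac_repr v).
have un0 := denom_ratioP (repr u); have vn0 := denom_ratioP (repr v).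
move: un0 vn0; move: \n_(repr u) \d_(repr u) \n_(repr v) \d_(repr v).
move=> a b c d bn0 dn0.
have phi0 e : e != 0 -> phi e != 0.
  by move=> en0; rewrite -(rmorph0 phi) (inj_eq phi_inj).
rewrite -mulNr addf_div ?tofrac_eq0 // -!tofracN -!tofracM -!tofracD.
rewrite !frac_mapE ?mulf_neq0 // -[- ((phi c)%:F / _)]mulNr.
rewrite addf_div ?tofrac_eq0 ?phi0 //.
by rewrite -tofracN -!tofracM -tofracD !(rmorphD, rmorphM, rmorphN).
Qed.

Lemma frac_map_is_monoid_morphism : monoid_morphism (frac_map phi).
Proof.
split; first by rewrite -tofrac1 frac_map_tofrac rmorph1 tofrac1.
move=> u v; rewrite (frac_repr u) (frac_repr v).
have un0 := denom_ratioP (repr u); have vn0 := denom_ratioP (repr v).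
rewrite mulf_div -!tofracM !frac_mapE ?mulf_neq0 // mulf_div.
by rewrite -!tofracM !rmorphM.
Qed.

End FracMapTheory.

Section Operators.
Variable k : fieldType.

(* h(t) |-> h(qt) on k(t). *)
Definition Qt1 (q : k) : ratfun k -> ratfun k :=
  frac_map (fun p : {poly k} => p \Po (q *: 'X)).

(* h(t, x) |-> h(qt, x) on k(t, x). *)
Definition Qt (q : k) : ratfun2 k -> ratfun2 k :=
  frac_map (map_poly (Qt1 q)).

Definition Sx : ratfun2 k -> ratfun2 k :=
  frac_map (fun p : {poly ratfun k} => p \Po ('X + 1)).

Definition Deltax (h : ratfun2 k) : ratfun2 k := Sx h - h.

Definition embt (e : ratfun k) : ratfun2 k := (e%:P)%:F.

(* The operator \sum_l e_l Q_t^l of k(t)<Q_t> is encoded by the polynomial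
   with coefficients e_l in k(t); only the underlying set is used, the
   product of {poly _} is not the composition of operators. *)
Definition op_apply (q : k) (L : {poly ratfun k}) (h : ratfun2 k) : ratfun2 k :=
  \sum_(l < size L) embt L`_l * iter l (Qt q) h.

Section Sanity.
Variable q : k.
Hypothesis q0 : q != 0.

Let dil : {rmorphism {poly k} -> {poly k}} := comp_poly (q *: 'X).

Lemma comp_poly_inj (F : fieldType) (r : {poly F}) :
  size r = 2 -> injective (comp_poly r).
Proof.
move=> sr; apply: raddf_inj => p /eqP.
by rewrite comp_poly_eq0 ?sr // => /eqP.
Qed.

Lemma dil_inj : injective dil.
Proof. by apply: comp_poly_inj; rewrite size_scale // size_polyX. Qed.

Lemma Qt1_is_zmod_morphism : zmod_morphism (Qt1 q).
Proof. exact: (frac_map_is_zmod_morphism dil_inj). Qed.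

Lemma Qt1_is_monoid_morphism : monoid_morphism (Qt1 q).
Proof. exact: (frac_map_is_monoid_morphism dil_inj). Qed.

Lemma Qt1_const (c : k) : Qt1 q (c%:P)%:F = (c%:P)%:F.
Proof. by rewrite /Qt1 (frac_map_tofrac dil_inj) /dil /= comp_polyC. Qed.

Lemma Qt1_t : Qt1 q 'X%:F = (q *: 'X)%:F.
Proof. by rewrite /Qt1 (frac_map_tofrac dil_inj) /dil /= comp_polyX. Qed.

#[local] HB.instance Definition _ :=
  GRing.isZmodMorphism.Build _ _ (Qt1 q) Qt1_is_zmod_morphism.
#[local] HB.instance Definition _ :=
  GRing.isMonoidMorphism.Build _ _ (Qt1 q) Qt1_is_monoid_morphism.

Let mdil : {rmorphism {poly ratfun k} -> {poly ratfun k}} := map_poly (Qt1 q).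

Lemma mdil_inj : injective mdil.
Proof. exact: map_poly_inj. Qed.

Lemma Qt_is_zmod_morphism : zmod_morphism (Qt q).
Proof. exact: (frac_map_is_zmod_morphism mdil_inj). Qed.

Lemma Qt_is_monoid_morphism : monoid_morphism (Qt q).
Proof. exact: (frac_map_is_monoid_morphism mdil_inj). Qed.

Lemma Qt_embt (e : ratfun k) : Qt q (embt e) = embt (Qt1 q e).
Proof. by rewrite /Qt (frac_map_tofrac mdil_inj) /mdil /= map_polyC. Qed.

Lemma Qt_x : Qt q 'X%:F = 'X%:F.
Proof. by rewrite /Qt (frac_map_tofrac mdil_inj) /mdil /= map_polyX. Qed.

End Sanity.

Let shift : {rmorphism {poly ratfun k} -> {poly ratfun k}} :=
  comp_poly ('X + 1).

Lemma shift_inj : injective shift.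
Proof. by apply: comp_poly_inj; rewrite -polyC1 size_XaddC. Qed.

Lemma Sx_is_zmod_morphism : zmod_morphism Sx.
Proof. exact: (frac_map_is_zmod_morphism shift_inj). Qed.

Lemma Sx_is_monoid_morphism : monoid_morphism Sx.
Proof. exact: (frac_map_is_monoid_morphism shift_inj). Qed.

Lemma Sx_embt (e : ratfun k) : Sx (embt e) = embt e.
Proof. by rewrite /Sx (frac_map_tofrac shift_inj) /shift /= comp_polyC. Qed.

Lemma Sx_x : Sx 'X%:F = 'X%:F + 1.
Proof.
by rewrite /Sx (frac_map_tofrac shift_inj) /shift /= comp_polyX tofracD tofrac1.
Qed.

End Operators.

(* The constant c, as an element of an extension iota : k(t) -> K. *)
Definition const_in (k K : fieldType) (iota : ratfun k -> K) (c : k) : K :=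
  iota (c%:P)%:F.

(* The right-hand side sum_i sum_{1 <= j <= n_i} alpha_{i,j} / (x - beta_i)^j,
   in K(x). *)
Definition pfrac (K : fieldType) (m : nat) (n : 'I_m -> nat)
    (alpha : 'I_m -> nat -> K) (beta : 'I_m -> K) : ratfun K :=
  \sum_(i < m) \sum_(1 <= j < (n i).+1)
    ((alpha i j)%:P)%:F / ('X - (beta i)%:P)%:F ^+ j.

(* Main.v *)
(* If all beta_i are in k, then f = p / d with d in k[x].  The Q_t^l p have
   bounded degree in x, so they are linearly dependent over k(t); such a
   relation is an L with L(f) = 0.
   Conversely, write f = a / b in lowest terms.  An irreducible d over k(t) with
   Q_t^i d = d(x + n) and i > 0 has its coefficients in k: comparing subleading
   coefficients gives c(q^i t) - c(t) in Z, which forces c in k.  Hence if b has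
   an irreducible factor not fixed by Q_t, its translates Q_t^j d(x + n) are
   pairwise coprime, so b meets only finitely many of them; take a common factor
   e of b and of a translate with j maximal.  If N is the order of L, the
   sum L(f) is regular at Q_t^N e(x + n) for all n <> 0, since the poles of f are
   inequivalent modulo Z, but not at Q_t^N e; no difference Delta_x g has
   such an isolated pole.  So all irreducible factors of b are fixed by Q_t,
   hence linear with root in k. *)
Require Import Defs.
From HB Require Import structures.
From mathcomp Require Import all_boot all_order all_algebra.
From mathcomp Require Import fraction.
From Stdlib Require Import Classical.

Set Implicit Arguments.
Unset Strict Implicit.
Unset Printing Implicit Defensive.

Import GRing.Theory Num.Theory.
Local Open Scope ring_scope.

(** * Lowest terms and coprimality *)

Lemma frac_coprime (F : fieldType) (u : ratfun F) :
  exists a b : {poly F}, [/\ b != 0, coprimep a b & u = a%:F / b%:F].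
Proof.
have d0 := denom_ratioP (repr u); move: (frac_repr u) d0.
move: \n_(repr u) \d_(repr u) => a b -> b0.
have g0 : gcdp a b != 0 by rewrite gcdp_eq0 (negPf b0) andbF.
have Ea := divpK (dvdp_gcdl a b); have Eb := divpK (dvdp_gcdr a b).
exists (a %/ gcdp a b), (b %/ gcdp a b); split.
- by rewrite divpN0 // dvdp_leq // dvdp_gcdr.
- by rewrite coprimep_div_gcd ?b0 ?orbT.
move: g0 Ea Eb; set g := gcdp _ _ => g0 Ea Eb.
rewrite -{1}Ea -{1}Eb !tofracM -mulf_div divff ?mulr1 //.
by rewrite tofrac_eq0.
Qed.

(** Induction on the degree of [b]: dividing [b] by its gcd with some [P i] lowers the degree, and
    the other [P j] are coprime to that gcd because they are coprime to [P i]. *)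
Lemma coprimep_all_but_finite (F : fieldType) (I : eqType) (P : I -> {poly F})
    (b : {poly F}) :
  (forall i j, i != j -> coprimep (P i) (P j)) -> b != 0 ->
  exists s : seq I, forall i, i \notin s -> coprimep (P i) b.
Proof.
move=> Pcop; have [N] := ubnP (size b); elim: N b => // N IH b sb b0.
have [[i Pib]|noP] := classic (exists i, ~~ coprimep (P i) b); last first.
  by exists [::] => i _; apply/negPn/negP => Pib; apply: noP; exists i.
have [gP gb] := (dvdp_gcdl (P i) b, dvdp_gcdr (P i) b).
set g := gcdp _ _ in gP gb; have Eb := divpK gb.
have : b %/ g * g != 0 by rewrite Eb.
rewrite mulf_eq0 negb_or => /andP[b'0 g0].
have sg : (1 < size g)%N.
  rewrite ltn_neqAle eq_sym; move: Pib; rewrite coprimep_def => ->.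
  by rewrite size_poly_gt0.
have [|s sP] := IH (b %/ g) _ b'0.
  rewrite -ltnS (leq_trans _ sb) // -{2}Eb size_mul //.
  move: sg; case: (size g) => [|[|m]] // _.
  by rewrite addnS /= addnS ltnS -addSn leq_addr.
exists (i :: s) => j; rewrite inE negb_or => /andP[ji js].
rewrite -Eb coprimepMr sP //=.
by apply: (coprimep_dvdl gP); apply: Pcop.
Qed.

(** * Regularity of a rational function at a polynomial *)

Section RegularAt.
Variable F : fieldType.
Implicit Types (d : {poly F}) (r : ratfun F).

(** Says that no pole of [r] is a root of [d]. Any denominator coprime to [d] is a witness, so sums
    are handled without reducing fractions. *)
Definition regular_at d r :=
  exists a b : {poly F}, [/\ b != 0, coprimep d b & r = a%:F / b%:F].

Lemma regular_atD d r s :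
  regular_at d r -> regular_at d s -> regular_at d (r + s).
Proof.
move=> [a [b [b0 db ->]]] [a' [b' [b'0 db' ->]]].
exists (a * b' + a' * b), (b * b'); split; rewrite ?mulf_neq0 //.
  by rewrite coprimepMr db.
by rewrite addf_div ?tofrac_eq0 // tofracD !tofracM.
Qed.

Lemma regular_atM d (c : {poly F}) r :
  regular_at d r -> regular_at d (c%:F * r).
Proof.
by move=> [a [b [b0 db ->]]]; exists (c * a), b; rewrite tofracM mulrA.
Qed.

Lemma regular_at_sum d (I : finType) (P : pred I) (r : I -> ratfun F) :
  (forall i, P i -> regular_at d (r i)) -> regular_at d (\sum_(i | P i) r i).
Proof.
move=> rP; apply: (big_ind (regular_at d)) => // [|x y].
  exists 0, 1; rewrite oner_eq0 coprimep1; split=> //.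
  by rewrite tofrac0 mul0r.
exact: regular_atD.
Qed.

Lemma regular_atB d r s :
  regular_at d r -> regular_at d s -> regular_at d (r - s).
Proof.
move=> rr /(regular_atM (- 1)); rewrite tofracN tofrac1 mulN1r.
exact: regular_atD.
Qed.

(** A denominator in lowest terms divides every other one, so regularity can be tested on it. *)
Lemma regular_at_coprime d (a b : {poly F}) :
  b != 0 -> coprimep a b -> regular_at d (a%:F / b%:F) -> coprimep d b.
Proof.
move=> b0 ab [a' [b' [b'0 db' /eqP]]].
rewrite eqr_div ?tofrac_eq0 // -!tofracM tofrac_eq => /eqP E.
have : b %| b' by rewrite -(@Gauss_dvdpr _ _ a) 1?coprimep_sym // E dvdp_mull.
by move=> bb'; apply: coprimep_dvdl bb' db'.
Qed.

Lemma regular_at_frac_map (phi : {rmorphism {poly F} -> {poly F}}) d r :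
  injective phi -> (forall a b, coprimep (phi a) (phi b) = coprimep a b) ->
  regular_at (phi d) (frac_map phi r) <-> regular_at d r.
Proof.
move=> phiI phiC; have phi0 b : b != 0 -> phi b != 0.
  by move=> b0; rewrite -(rmorph0 phi) (inj_eq phiI).
have [a [b [b0 ab ->]]] := frac_coprime r; rewrite frac_mapE //.
split=> H.
  exists a, b; split=> //; rewrite -phiC.
  by apply: regular_at_coprime H; rewrite ?phi0 ?phiC.
exists (phi a), (phi b); split=> //; first exact: phi0.
by rewrite phiC (regular_at_coprime b0 ab).
Qed.

End RegularAt.

(** * Integer translations of x *)

Section Shift.
Variable F : fieldType.
Implicit Types (p : {poly F}) (m n : int).

Definition shiftp n p := p \Po ('X + (n%:~R)%:P).

HB.instance Definition _ n :=
  GRing.RMorphism.copy (shiftp n) (comp_poly ('X + (n%:~R : F)%:P)).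

Lemma shiftpE1 : shiftp 1 = comp_poly ('X + 1).
Proof. by rewrite /shiftp -polyC1. Qed.

Lemma shiftp0 p : shiftp 0 p = p.
Proof. by rewrite /shiftp addr0 comp_polyXr. Qed.

Lemma shiftpD m n p : shiftp m (shiftp n p) = shiftp (m + n) p.
Proof.
rewrite /shiftp -comp_polyA comp_polyD comp_polyX comp_polyC.
by rewrite -addrA -polyCD intrD.
Qed.

Lemma shiftp_inj n : injective (shiftp n).
Proof.
by apply: (can_inj (g := shiftp (- n))) => p; rewrite shiftpD addNr shiftp0.
Qed.

Lemma coprimep_shiftp n p q : coprimep (shiftp n p) (shiftp n q) = coprimep p q.
Proof.
apply/idP/idP; last exact: coprimep_comp_poly.
move/(coprimep_comp_poly ('X + ((- n)%:~R)%:P)).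
by rewrite -/(shiftp _ _) -/(shiftp _ (shiftp n q)) !shiftpD addNr !shiftp0.
Qed.

Lemma dvdp_shiftp n p q : p %| q -> shiftp n p %| shiftp n q.
Proof. exact: dvdp_comp_poly. Qed.

Lemma size_shiftp n p : size (shiftp n p) = size p.
Proof. by rewrite size_comp_poly2 // size_XaddC. Qed.

Lemma shiftp_monic n p : p \is monic -> shiftp n p \is monic.
Proof.
by move=> /monicP pm; rewrite monicE lead_coef_comp ?size_XaddC // pm lead_coefXaddC
  expr1n mulr1.
Qed.

Lemma map_shiftp (sigma : {rmorphism F -> F}) n p :
  map_poly sigma (shiftp n p) = shiftp n (map_poly sigma p).
Proof.
by rewrite map_comp_poly rmorphD /= map_polyX map_polyC /= rmorph_int.
Qed.

(** Binomial expansion in the two top degrees; the change in the subleading coefficient is what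
    detects a translation. *)
Lemma coef_comp_XaddC (c : F) r p : (size p <= r.+2)%N ->
  (p \Po ('X + c%:P))`_r.+1 = p`_r.+1 /\
  (p \Po ('X + c%:P))`_r = p`_r + p`_r.+1 * c *+ r.+1.
Proof.
elim/poly_ind: p r => [|p a IH] r sp.
  by rewrite comp_poly0 !coef0 mul0r mul0rn addr0.
have {}sp : (size p <= r.+1)%N.
  have [->|p0] := eqVneq p 0; first by rewrite size_poly0.
  by move: sp; rewrite size_MXaddC (negPf p0) ltnS.
rewrite comp_polyD comp_polyM comp_polyX comp_polyC mulrDr.
rewrite !coefD !coefMX !coefMC !coefC /= !addr0.
have [pr pr1] : (p \Po ('X + c%:P))`_r = p`_r /\ (p \Po ('X + c%:P))`_r.+1 = 0.
  split; last first.
    by rewrite nth_default // size_comp_poly2 ?size_XaddC.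
  case: r sp => [|r] sp; last by have [] := IH r sp.
  by rewrite (size1_polyC sp) comp_polyC.
rewrite pr pr1 mul0r addr0; split=> //.
case: r sp pr pr1 => [|r] sp pr pr1 /=.
  by rewrite mulr1n !add0r addrC.
have [_ ->] := IH r sp.
by rewrite !addr0 -addrA -mulrSr.
Qed.

End Shift.

Lemma intr_eq0_char0 (F : fieldType) (char0 : [pchar F] =i pred0) (n : int) :
  (n%:~R == 0 :> F) = (n == 0).
Proof.
have H := (pcharf0P F).1 char0.
by case: n => n; rewrite ?NegzE ?rmorphN ?oppr_eq0 /= -?pmulrn H.
Qed.

(** * Isolated poles, and orbits under [sigma] and translations *)

Section Telescoping.
Variable F : fieldType.
Implicit Types p : {poly F}.

Local Notation Sh := (frac_map (fun p : {poly F} => p \Po ('X + 1))).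

Lemma regular_at_Sh n p r :
  regular_at (shiftp (n + 1) p) (Sh r) <-> regular_at (shiftp n p) r.
Proof.
have := @regular_at_frac_map F (shiftp 1) (shiftp n p) r (@shiftp_inj F 1)
  (coprimep_shiftp 1).
by rewrite /= shiftpD addrC shiftpE1.
Qed.

(* A pole of [Sh g - g] cannot be alone in its [Z]-orbit: otherwise regularity
   of [g] propagates from infinity along the orbit from both sides. *)
Lemma regular_at_difference p g :
  (forall n : int, n != 0 -> coprimep p (shiftp n p)) ->
  (forall n : int, n != 0 -> regular_at (shiftp n p) (Sh g - g)) ->
  regular_at p (Sh g - g).
Proof.
move=> pcop hreg.
have [a [b [b0 ab Eg]]] := frac_coprime g.
have [s sP] : exists s : seq int, forall i, i \notin s -> coprimep (shiftp i p) b.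
  apply: coprimep_all_but_finite b0 => i j ij.
  rewrite -[in shiftp j p](subrK i j) addrC -shiftpD coprimep_shiftp pcop //.
  by rewrite subr_eq0 eq_sym.
pose M := (\max_(i <- s) `|i|)%N.
have far n : (M < `|n|)%N -> regular_at (shiftp n p) g.
  move=> Mn; exists a, b; split=> //; apply: sP; apply/negP => ns.
  by move: Mn; rewrite ltnNge /M (@leq_bigmax_seq int s xpredT absz).
(* [Sh g] at index [n + 1] reflects [g] at [n], and the difference is regular at [n + 1]; passage is
   blocked only between -1 and 0. *)
have step n : n + 1 != 0 ->
    regular_at (shiftp n p) g <-> regular_at (shiftp (n + 1) p) g.
  move=> n1; rewrite -regular_at_Sh; split=> H.
    by rewrite -[g](subKr (Sh g)); apply: regular_atB => //; apply: hreg.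
  by rewrite -[Sh g](subrK g); apply: regular_atD => //; apply: hreg.
have pos (n : nat) : regular_at p g <-> regular_at (shiftp n p) g.
  elim: n => [|n IH]; first by rewrite shiftp0.
  by rewrite IH -(addn1 n) PoszD; apply: step; rewrite -PoszD addn1.
have neg (n : nat) :
    regular_at (shiftp (- 1) p) g <-> regular_at (shiftp (- n.+1%:Z) p) g.
  elim: n => [|n IH] //; rewrite IH.
  have E : - n.+2%:Z + 1 = - n.+1%:Z by rewrite -[n.+2]addn1 PoszD opprD addrNK.
  by have := step (- n.+2%:Z); rewrite E oppr_eq0 => ->.
apply: regular_atB; last by apply/(pos M.+1)/far.
have := regular_at_Sh (- 1) p g; rewrite addNr shiftp0 => ->.
by apply/(neg M)/far; rewrite abszN.
Qed.

Variable sigma : {rmorphism F -> F}.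
Local Notation Q := (frac_map (map_poly sigma)).
Local Notation mp := (map_poly sigma).

Hypothesis char0 : [pchar F] =i pred0.
(** What is used of Q_t on k(t): no positive power moves an element by a nonzero integer, and
    periodic elements are fixed. *)
Hypothesis sigma_shift : forall i c (n : int), (0 < i)%N ->
  iter i sigma c = c + n%:~R -> n = 0 /\ sigma c = c.

Lemma coef_iter_map i p j : (iter i mp p)`_j = iter i sigma p`_j.
Proof. by elim: i => //= i <-; rewrite coef_map. Qed.

Lemma iter_map_shiftp i n p : iter i mp (shiftp n p) = shiftp n (iter i mp p).
Proof. by elim: i => //= i ->; rewrite map_shiftp. Qed.

Lemma coprimep_iter_map i p q : coprimep (iter i mp p) (iter i mp q) = coprimep p q.
Proof. by elim: i => //= i <-; rewrite coprimep_map. Qed.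

Lemma dvdp_iter_map i p q : p %| q -> iter i mp p %| iter i mp q.
Proof. by move=> pq; elim: i => //= i; rewrite dvdp_map. Qed.

Lemma size_iter_map i p : size (iter i mp p) = size p.
Proof. by elim: i => //= i <-; rewrite size_map_poly. Qed.

Lemma iter_map_monic i p : p \is monic -> iter i mp p \is monic.
Proof. by move=> pm; elim: i => //= i H; rewrite map_monic. Qed.

Lemma regular_at_iter_map i p r :
  regular_at (iter i mp p) (iter i Q r) <-> regular_at p r.
Proof.
elim: i => //= i <-; apply: regular_at_frac_map; first exact: map_poly_inj.
by move=> a b; rewrite coprimep_map.
Qed.

(** The subleading coefficient forces [n = 0]; if [i > 0], every coefficient of [p] is then periodic
    under [sigma], hence fixed, which the last hypothesis excludes. *)
Lemma iter_map_shiftp_fixed i n p : p \is monic -> (1 < size p)%N ->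
  iter i mp (shiftp n p) = p -> (i == 0%N) || (mp p != p) -> i = 0%N /\ n = 0.
Proof.
move=> pm sp E nfix.
have [r sr] : exists r, size p = r.+2.
  by case: (size p) sp => [|[|r]] // _; exists r.
have pr1 : p`_r.+1 = 1 by move/monicP: pm; rewrite lead_coefE sr.
(* Since [r.+1] is the degree of the monic [p], the shift adds [n] times the degree to this
   coefficient. *)
have Er : iter i sigma p`_r = p`_r + (- (n *+ r.+1))%:~R.
  have := congr1 (fun p : {poly F} => p`_r) E.
  rewrite iter_map_shiftp.
  have sip : (size (iter i mp p) <= r.+2)%N by rewrite size_iter_map sr.
  have [_ ->] := coef_comp_XaddC n%:~R sip.
  rewrite !coef_iter_map pr1.
  have -> : iter i sigma 1 = 1 by elim: (i) => //= j ->; rewrite rmorph1.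
  by rewrite mul1r => /(canRL (addrK _)) ->; rewrite rmorphN rmorphMn.
case: (posnP i) E nfix Er => [->|i0] E nfix /=.
  rewrite -[LHS]addr0 => /addrI/esym/eqP; rewrite (intr_eq0_char0 char0) oppr_eq0.
  by rewrite mulrn_eq0 /= => /eqP.
case/(sigma_shift i0) => /eqP; rewrite oppr_eq0 mulrn_eq0 /= => /eqP n0 _.
case/eqP: nfix; move: i0; case: i E => // i E _; move: E.
rewrite n0 shiftp0 => E.
apply/polyP => j; rewrite coef_map /=.
have [] // := @sigma_shift i.+1 p`_j 0 isT.
by rewrite -coef_iter_map E addr0.
Qed.

(** An irreducible monic polynomial is coprime or equal to a monic one of the same degree. *)
Lemma orbit_coprime p : irreducible_poly p -> p \is monic -> mp p != p ->
  forall i n, (i, n) != (0%N, 0%Z) -> coprimep p (iter i mp (shiftp n p)).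
Proof.
move=> pirr pm nfix i n; rewrite irreducible_poly_coprime // => in0.
apply: contra in0 => pdvd.
have := dvdp_size_eqp pdvd; rewrite size_iter_map size_shiftp eqxx.
rewrite eqp_monic ?iter_map_monic ?shiftp_monic // => /esym/eqP E.
have [|-> ->] := iter_map_shiftp_fixed pm pirr.1 (esym E); last by [].
by rewrite nfix orbT.
Qed.

Lemma extremal_factor D b : irreducible_poly D -> D \is monic -> mp D != D ->
  b != 0 -> D %| b ->
  exists e, [/\ e %| b, (1 < size e)%N &
    forall j n, (0 < j)%N -> coprimep (iter j mp (shiftp n e)) b].
Proof.
move=> Dirr Dm Dnfix b0 Db.
pose P (i : nat * int) := iter i.1 mp (shiftp i.2 D).
have Pcop i j : i != j -> coprimep (P i) (P j).
  wlog ij : i j / (i.1 <= j.1)%N => [IH|].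
    by case: (leqP i.1 j.1) => [/IH //|/ltnW/IH ji]; rewrite eq_sym coprimep_sym.
  case: i j ij => [i m] [j n] /= ij nij; rewrite /P /=.
  rewrite -(subnKC ij) iterD coprimep_iter_map -(subrKC m n) -shiftpD.
  rewrite iter_map_shiftp coprimep_shiftp orbit_coprime //.
  apply: contra nij => /eqP[/eqP]; rewrite subn_eq0 => ji /eqP.
  by rewrite subr_eq0 => /eqP ->; rewrite (anti_leq (introT andP (conj ij ji))).
have [s sP] := coprimep_all_but_finite Pcop b0.
pose A j := has (fun i => (i.1 == j) && ~~ coprimep (P i) b) s.
have exA : exists j, A j.
  have D0 : ~~ coprimep (P (0%N, 0%Z)) b.
    by rewrite /P /= shiftp0 irreducible_poly_coprime // Db.
  exists 0%N; apply/hasP; exists (0%N, 0%Z) => //=.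
  by apply: contraR D0 => /sP.
have ubA j : A j -> (j <= \max_(i <- s) i.1)%N.
  by case/hasP => i si /andP[/eqP <- _]; apply: (@leq_bigmax_seq _ s xpredT fst).
case: (ex_maxnP exA ubA) => J /hasP[[i n] _ /= /andP[/eqP -> Jb]] Jmax.
(* [J] is the largest power of [sigma] whose translates of [D] meet [b]; a positive power of [sigma]
   applied to this gcd divides a translate of index beyond [J]. *)
exists (gcdp (P (J, n)) b); split; first exact: dvdp_gcdr.
  rewrite ltn_neqAle eq_sym; move: Jb; rewrite coprimep_def => ->.
  by rewrite size_poly_gt0 gcdp_eq0 (negPf b0) andbF.
move=> j m j0; apply: (@coprimep_dvdr _ (P ((j + J)%N, m + n))).
  have -> : P ((j + J)%N, m + n) = iter j mp (shiftp m (P (J, n))).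
    by rewrite /P iterD /= -shiftpD (iter_map_shiftp J).
  by apply/dvdp_iter_map/dvdp_shiftp/dvdp_gcdl.
apply/negPn/negP => nc; suff /Jmax : A (j + J)%N.
  by rewrite leqNgt -{1}[J]add0n ltn_add2r j0.
apply/hasP; exists ((j + J)%N, m + n); rewrite ?eqxx //.
by apply: contraR nc => /sP.
Qed.

(** The necessity half over any field with such a [sigma]. Coprimality of [b] with its shifts
    expresses that the poles are inequivalent modulo Z. *)
Theorem telescoper_fixes_denominator (L : {poly F}) (a b : {poly F}) g :
  L != 0 -> b != 0 -> coprimep a b ->
  (forall n : int, n != 0 -> coprimep b (shiftp n b)) ->
  \sum_(l < size L) ((L`_l)%:P)%:F * iter l Q (a%:F / b%:F) = Sh g - g ->
  forall D, irreducible_poly D -> D \is monic -> D %| b -> mp D = D.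
Proof.
move=> L0 b0 ab bcop ELf D Dirr Dm Db; apply/eqP/negPn/negP => Dnfix.
have [e [eb se ecop]] := extremal_factor Dirr Dm Dnfix b0 Db.
set f := a%:F / b%:F in ELf.
have [N sL] : exists N, size L = N.+1.
  by exists (size L).-1; rewrite prednK // size_poly_gt0.
have freg p : coprimep p b -> regular_at p f by exists a, b.
(* For [l < N], cancelling [sigma^l] leaves a positive power of [sigma] on [e], which is coprime to
   [b] after any shift. *)
have termreg n (l : 'I_N) :
    regular_at (shiftp n (iter N mp e)) (((L`_l)%:P)%:F * iter l Q f).
  apply: regular_atM; rewrite -iter_map_shiftp; case: l => l /= lN.
  rewrite -(subnKC (ltnW lN)) iterD.
  by apply/regular_at_iter_map/freg/ecop; rewrite subn_gt0.
have bshift n : n != 0 -> coprimep (shiftp n e) b.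
  move=> n0; apply: (@coprimep_dvdr _ (shiftp n b)); last first.
    by rewrite coprimep_sym bcop.
  exact: dvdp_shiftp.
have lastreg n : n != 0 -> regular_at (shiftp n (iter N mp e)) (iter N Q f).
  by move=> n0; rewrite -iter_map_shiftp; apply/regular_at_iter_map/freg/bshift.
rewrite sL big_ord_recr /= in ELf.
have hreg : regular_at (iter N mp e) (Sh g - g).
  apply: regular_at_difference => n n0.
    rewrite -iter_map_shiftp coprimep_iter_map coprimep_sym.
    by apply: coprimep_dvdl eb (bshift n n0).
  rewrite -ELf; apply: regular_atD; first exact: regular_at_sum.
  exact: regular_atM (lastreg n n0).
have LN : L`_N != 0 by rewrite -[N]/N.+1.-1 -sL -lead_coefE lead_coef_eq0.
(* Solving for the top term makes [sigma^N f] regular at [sigma^N e]; then [e] is coprime to [b],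
   although it is a nonconstant divisor of [b]. *)
have : regular_at (iter N mp e) (iter N Q f).
  have -> : iter N Q f = ((L`_N)^-1%:P)%:F * ((Sh g - g) -
      \sum_(l < N) ((L`_l)%:P)%:F * iter l Q f).
    rewrite -ELf [X in X - _]addrC addrK mulrA -tofracM -polyCM mulVf //.
    by rewrite tofrac1 mul1r.
  apply/regular_atM/regular_atB => //; apply: regular_at_sum => l _.
  by have := termreg 0 l; rewrite shiftp0.
move/regular_at_iter_map/(regular_at_coprime b0 ab).
by rewrite coprimep_sym => /(coprimep_dvdr eb); rewrite coprimepp gtn_eqF.
Qed.

End Telescoping.

(** * Dilations of rational functions in t *)

Section Dilation.
Variable k : fieldType.
Implicit Types (q : k) (p : {poly k}).

Lemma coef_dilate q p i : (p \Po (q *: 'X))`_i = q ^+ i * p`_i.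
Proof.
elim/poly_ind: p i => [|p a IH] i; first by rewrite comp_poly0 coef0 mulr0.
rewrite comp_polyD comp_polyM comp_polyX comp_polyC !coefD !coefC.
rewrite -scalerAr coefZ !coefMX; case: i => [|i] /=.
  by rewrite mulr0 !add0r mul1r.
by rewrite !addr0 IH exprS mulrA.
Qed.

Lemma iter_Qt1_frac q (q0 : q != 0) i (u v : {poly k}) : v != 0 ->
  iter i (Qt1 q) (u%:F / v%:F) =
  (u \Po (q ^+ i *: 'X))%:F / (v \Po (q ^+ i *: 'X))%:F.
Proof.
move=> v0; elim: i => [|i IH] /=; first by rewrite !scale1r !comp_polyXr.
have qi0 : q ^+ i != 0 by rewrite expf_neq0.
rewrite IH /Qt1 (frac_mapE (dil_inj q0)); last first.
  by rewrite -(comp_poly0 (q ^+ i *: 'X)) (inj_eq (dil_inj qi0)).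
have E p : (p \Po (q ^+ i *: 'X)) \Po (q *: 'X) = p \Po (q ^+ i.+1 *: 'X).
  by rewrite -comp_polyA comp_polyZ comp_polyX scalerA -exprSr.
by rewrite /= !E.
Qed.

(** With c = u/v in lowest terms, v(rt) is proportional to v, so v is a monomial, the powers of r
    being distinct. Comparing coefficients then gives e = 0 and makes u a multiple of v. *)
Lemma iter_Qt1_shift q (i : nat) (c : ratfun k) (e : k) :
  q != 0 -> (forall j, (0 < j)%N -> q ^+ j != 1) -> (0 < i)%N ->
  iter i (Qt1 q) c = c + (e%:P)%:F -> e = 0 /\ exists c0 : k, c = (c0%:P)%:F.
Proof.
move=> q0 qroot i0; have [u [v [v0 uv ->]]] := frac_coprime c.
rewrite iter_Qt1_frac //; set r := q ^+ i.
have r0 : r != 0 by rewrite expf_neq0.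
have rinj (j l : nat) : r ^+ j = r ^+ l -> j = l.
  wlog jl : j l / (j <= l)%N => [IH|].
    by case: (leqP j l) => [/IH //|/ltnW/IH H /esym/H].
  rewrite -(subnKC jl) exprD -{1}[r ^+ j]mulr1.
  move=> /(mulfI (expf_neq0 _ r0))/esym/eqP.
  case: (l - j)%N => [|m]; first by rewrite addn0.
  by rewrite -exprM (negPf (qroot _ _)) // muln_gt0 i0.
have dv0 : v \Po (r *: 'X) != 0.
  by rewrite -(comp_poly0 (r *: 'X)) (inj_eq (dil_inj r0)).
have -> : u%:F / v%:F + (e%:P)%:F = (u + e *: v)%:F / v%:F.
  by rewrite tofracD -mul_polyC tofracM mulrDl mulfK ?tofrac_eq0.
move=> /eqP; rewrite eqr_div ?tofrac_eq0 // -!tofracM tofrac_eq => /eqP E.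
have vdv : v %| v \Po (r *: 'X).
  rewrite -(@Gauss_dvdpr _ _ (u + e *: v)) -?E ?dvdp_mull //.
  by rewrite -mul_polyC addrC coprimep_addl_mul coprimep_sym.
have := dvdp_size_eqp vdv.
rewrite size_comp_poly2 ?size_scale ?size_polyX // eqxx.
move=> /esym/eqpP[[c1 c2] /= /andP[c10 c20] Ev].
set s := (size v).-1; have vs0 : v`_s != 0 by rewrite -lead_coefE lead_coef_eq0.
have Ec1 : c1 = c2 * r ^+ s.
  have := congr1 (fun p : {poly k} => p`_s) Ev.
  by rewrite !coefZ coef_dilate mulrA => /(mulIf vs0).
have vE j : j != s -> v`_j = 0.
  move=> js; apply: contraNeq js => vj; apply/eqP/rinj.
  have := congr1 (fun p : {poly k} => p`_j) Ev.
  by rewrite !coefZ coef_dilate mulrA Ec1 => /(mulIf vj)/(mulfI c20).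
have {}Ev : v \Po (r *: 'X) = r ^+ s *: v.
  by apply: (scalerI c20); rewrite -Ev scalerA Ec1.
move: E; rewrite Ev -scalerAr scalerAl => /(mulIf v0) E.
have uE j : r ^+ j * u`_j = r ^+ s * (u`_j + e * v`_j).
  have := congr1 (fun p : {poly k} => p`_j) E.
  by rewrite coef_dilate coefZ coefD coefZ.
have e0 : e = 0.
  have /eqP := uE s; rewrite mulrDr -[LHS in LHS == _]addr0.
  rewrite (inj_eq (addrI _)) eq_sym !mulf_eq0 expf_eq0 (negPf r0) andbF (negPf vs0).
  by rewrite orbF => /eqP.
split=> //; exists (u`_s / v`_s).
have Eu : u = (u`_s / v`_s) *: v.
  apply/polyP => j; rewrite coefZ; have [->|js] := eqVneq j s.
    by rewrite divfK.
  rewrite (vE j js) mulr0; apply: contraNeq js => uj; apply/eqP/rinj.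
  by have := uE j; rewrite e0 mul0r addr0 => /(mulIf uj).
by rewrite {1}Eu -mul_polyC tofracM mulfK ?tofrac_eq0.
Qed.

End Dilation.

(** * Minimal polynomials in a field extension *)

Section FieldExtension.
Variables (F K : fieldType) (iota : {rmorphism F -> K}).
Local Notation mi := (map_poly iota).

(** [d] is the minimal polynomial of [z]: whenever [b] factors properly, [z] is a root of a factor
    of smaller degree. *)
Lemma irreducible_factor_root (b : {poly F}) (z : K) :
  b != 0 -> root (mi b) z ->
  exists d : {poly F}, [/\ irreducible_poly d, d \is monic, d %| b & root (mi d) z].
Proof.
have [N] := ubnP (size b); elim: N b => // N IH b sb b0 bz.
have bs : (1 < size b)%N.
  rewrite ltnNge; apply/negP => /size1_polyC Eb.
  move: bz b0; rewrite Eb map_polyC /= rootC fmorph_eq0 => /eqP ->.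
  by rewrite eqxx.
have [birr|] := classic (irreducible_poly b).
  have l0 : (lead_coef b)^-1 != 0 by rewrite invr_eq0 lead_coef_eq0.
  have lb := eqp_scale b l0.
  exists ((lead_coef b)^-1 *: b); split.
  - split=> [|q sq]; first by rewrite (eqp_size lb).
    by rewrite (eqp_dvdr _ lb) => /(birr.2 q sq)/eqp_trans; apply; rewrite eqp_sym.
  - by rewrite monicE lead_coefZ mulVf ?lead_coef_eq0.
  - by rewrite (eqp_dvdl _ lb).
  - by rewrite map_polyZ /= rootZ ?fmorph_eq0.
move=> nirr.
have [c [cb sc cNb]] :
    exists c : {poly F}, [/\ c %| b, size c != 1%N & ~~ (c %= b)].
  apply: NNPP => H; apply: nirr; split=> // c sc cb; apply/negPn/negP => cNb.
  by apply: H; exists c.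
have Eb := divpK cb; have : b %/ c * c != 0 by rewrite Eb.
rewrite mulf_eq0 negb_or => /andP[e0 c0].
have small d : d %| b -> ~~ (d %= b) -> d != 0 -> root (mi d) z ->
    exists d : {poly F},
      [/\ irreducible_poly d, d \is monic, d %| b & root (mi d) z].
  move=> db dNb d0 dz; have [|d' [? ? d'd ?]] := IH d _ d0 dz.
    rewrite -ltnS (leq_trans _ sb) // ltnS ltn_neqAle dvdp_leq // andbT.
    by rewrite dvdp_size_eqp.
  by exists d'; split=> //; apply: dvdp_trans db.
move: bz; rewrite -Eb rmorphM rootM => /orP[ez|cz]; last first.
  by rewrite Eb; apply: small cz.
rewrite Eb; apply: small ez => //; first by rewrite -{2}Eb dvdp_mulr.
rewrite -dvdp_size_eqp -{2}Eb ?dvdp_mulr // size_mul //.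
have : (1 < size c)%N by rewrite ltn_neqAle eq_sym sc size_poly_gt0.
case: (size c) => [|[|n]] // _; rewrite addnS /= addnS.
by rewrite ltn_eqF // ltnS leq_addr.
Qed.

End FieldExtension.

(** * Common denominator of a partial fraction *)

Section PartialFractions.
Variables (K : fieldType) (m : nat) (n : 'I_m -> nat).
Variables (alpha : 'I_m -> nat -> K) (beta : 'I_m -> K).

Definition pfrac_denom : {poly K} := \prod_(i < m) ('X - (beta i)%:P) ^+ n i.

Lemma pfrac_denom_neq0 : pfrac_denom != 0.
Proof. by apply/prodf_neq0 => i _; rewrite expf_neq0 ?polyXsubC_eq0. Qed.

Lemma root_pfrac_denom z : root pfrac_denom z -> exists i, z = beta i.
Proof.
rewrite /root horner_prod prodf_seq_eq0 => /hasP[i _ /=].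
rewrite horner_exp expf_eq0 => /andP[_]; rewrite -/(root _ _) root_XsubC => /eqP.
by exists i.
Qed.

(** Nothing cancels: at [beta i] the numerator reduces to the term j = n_i of block i, namely
    [alpha i (n i)] times a product of nonzero factors. *)
Lemma pfracE : injective beta -> (forall i, (0 < n i)%N) ->
    (forall i, alpha i (n i) != 0) ->
  exists P : {poly K}, pfrac n alpha beta = P%:F / pfrac_denom%:F /\
    forall i, ~~ root P (beta i).
Proof.
move=> betaI n0 alpha0.
pose A i :=
  \sum_(1 <= j < (n i).+1) (alpha i j)%:P * ('X - (beta i)%:P) ^+ (n i - j).
pose E i := \prod_(i' < m | i' != i) ('X - (beta i')%:P) ^+ n i'.
exists (\sum_(i < m) A i * E i); split.
  rewrite rmorph_sum /= mulr_suml; apply: eq_bigr => i _.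
  rewrite /pfrac_denom (bigD1 i) //= -/(E i) !tofracM -mulf_div.
  have Ei0 : (E i)%:F != 0.
    rewrite tofrac_eq0; apply/prodf_neq0 => j _.
    by rewrite expf_neq0 ?polyXsubC_eq0.
  rewrite divff // mulr1 rmorph_sum /= mulr_suml !big_nat; apply: eq_bigr => j.
  case/andP => _; rewrite ltnS => jn; rewrite tofracM !tofracXn.
  have X0 : ('X - (beta i)%:P)%:F != 0 by rewrite tofrac_eq0 polyXsubC_eq0.
  set x := _%:F in X0 *; have -> : x ^+ n i = x ^+ j * x ^+ (n i - j).
    by rewrite -exprD subnKC.
  rewrite -[LHS]mulr1 -(divff (expf_neq0 (n i - j) X0)).
  exact: mulf_div.
move=> i; rewrite /root horner_sum (bigD1 i) //= [X in _ + X]big1 => [|j ji].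
  rewrite addr0 hornerM mulf_neq0 //.
    rewrite /A horner_sum big_nat_recr //= big1_seq => [|j]; last first.
      rewrite mem_index_iota => /andP[_ /andP[_ jn]].
      rewrite hornerM horner_exp hornerXsubC subrr expr0n subn_eq0 leqNgt jn.
      by rewrite mulr0.
    by rewrite add0r subnn expr0 mulr1 hornerC.
  rewrite horner_prod; apply/prodf_neq0 => j ji.
  by rewrite horner_exp hornerXsubC expf_neq0 // subr_eq0 eq_sym (inj_eq betaI).
rewrite hornerM horner_prod (bigD1 i) 1?eq_sym //=.
by rewrite horner_exp hornerXsubC subrr expr0n gtn_eqF // mul0r mulr0.
Qed.

End PartialFractions.

(** * Annihilating operators for a fixed denominator *)

Lemma annihilator_exists (F : fieldType) (sigma : {rmorphism F -> F})
    (p d : {poly F}) :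
  d != 0 -> map_poly sigma d = d ->
  exists2 L : {poly F}, L != 0 &
    \sum_(l < size L) ((L`_l)%:P)%:F *
      iter l (frac_map (map_poly sigma)) (p%:F / d%:F) = 0.
Proof.
move=> d0 dfix; set mp := map_poly sigma in dfix *; set s := size p.
have iterE l : iter l (frac_map mp) (p%:F / d%:F) = (iter l mp p)%:F / d%:F.
  elim: l => //= l ->; rewrite (frac_mapE (phi := map_poly sigma)) //=.
    by rewrite -/mp dfix.
  exact: map_poly_inj.
(* As [d] is fixed, only the numerators move, and their size stays [s]. So [s.+1] rows in dimension
   [s] are dependent, and a relation gives the coefficients of [L]. *)
pose M : 'M[F]_(s.+1, s) := \matrix_(l < s.+1) poly_rV (iter l mp p).
have : kermx M != 0.
  rewrite kermx_eq0 /row_free; apply: contraTN (rank_leq_col M) => /eqP ->.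
  by rewrite ltnn.
case/rowV0Pn => v /sub_kermxP vM v0; exists (rVpoly v).
  by apply: contraNneq v0 => Lv; rewrite -[v]rVpolyK Lv linear0.
have sL : (size (rVpoly v) <= s.+1)%N by apply: size_poly.
rewrite (big_ord_widen s.+1 (fun l => (((rVpoly v)`_l)%:P)%:F *
  iter l (frac_map mp) (p%:F / d%:F)) sL) big_mkcond /=.
rewrite (eq_bigr (fun l : 'I_s.+1 =>
  (v 0 l *: iter l mp p)%:F / d%:F)) => [|l _]; last first.
  rewrite -mul_polyC tofracM iterE mulrA -coef_rVpoly_ord.
  by case: ltnP => // /(nth_default 0) ->; rewrite polyC0 tofrac0 !mul0r.
rewrite -mulr_suml -rmorph_sum /=.
suff -> : \sum_(l < s.+1) v 0 l *: iter l mp p = 0 by rewrite tofrac0 mul0r.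
have := congr1 rVpoly vM; rewrite mulmx_sum_row linear_sum linear0 /= => E.
rewrite -[RHS]E; apply: eq_bigr => l _; rewrite linearZ /= rowK poly_rV_K //.
by rewrite (@size_iter_map F sigma).
Qed.

(** * Irreducible polynomials fixed by Q_t *)

Section FixedFactors.
Variables (k : closedFieldType) (q : k).
Hypotheses (char0 : [pchar k] =i pred0) (q0 : q != 0).
Hypothesis hq : forall i : int, i != 0 -> q ^ i != 1.

Lemma q_not_root_of_unity (j : nat) : (0 < j)%N -> q ^+ j != 1.
Proof. by move=> j0; apply: (hq (i := j%:Z)); rewrite eqz_nat -lt0n. Qed.

Definition constm : {rmorphism k -> ratfun k} := @FracField.tofrac _ \o polyC.

(** The morphism laws of [Qt1 q] are proved under [q0], so the structure is packed by hand. *)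
Definition Qt1_rmorphism : {rmorphism ratfun k -> ratfun k} :=
  HB.pack (Qt1 q)
    (GRing.isZmodMorphism.Build _ _ (Qt1 q) (Qt1_is_zmod_morphism q0))
    (GRing.isMonoidMorphism.Build _ _ (Qt1 q) (Qt1_is_monoid_morphism q0)).

Lemma char0_ratfun : [pchar (ratfun k)] =i pred0.
Proof. by move=> p; rewrite (fmorph_pchar constm) char0. Qed.

(** Supplies [sigma_shift] for Q_t. *)
Lemma Qt1_int_shift i (c : ratfun k) (n : int) : (0 < i)%N ->
  iter i (Qt1 q) c = c + n%:~R -> n = 0 /\ Qt1 q c = c.
Proof.
move=> i0; have -> : n%:~R = ((n%:~R : k)%:P)%:F :> ratfun k.
  by rewrite -[RHS]/(constm n%:~R) rmorph_int.
case/(iter_Qt1_shift q0 _ i0) => [|/eqP]; first exact: q_not_root_of_unity.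
rewrite (intr_eq0_char0 char0) => /eqP -> [c0 ->].
by rewrite Qt1_const.
Qed.

Lemma Qt1_fixed (c : ratfun k) : Qt1 q c = c -> exists c0 : k, c = constm c0.
Proof.
move=> Ec; have [|//|_ //] := @iter_Qt1_shift k q 1 c 0 q0 _ (ltn0Sn 0).
  exact: q_not_root_of_unity.
by rewrite /= Ec tofrac0 addr0.
Qed.

(** Fixed coefficients are constants, so [d] comes from k[x] and has a root in the algebraically
    closed field k. *)
Lemma irreducible_fixed (d : {poly ratfun k}) :
  irreducible_poly d -> map_poly (Qt1 q) d = d ->
  exists c : k, d %= 'X - (constm c)%:P.
Proof.
move=> dirr dfix.
have dconst i : exists c0, d`_i = constm c0.
  apply: Qt1_fixed.
  have := congr1 (fun p : {poly ratfun k} => p`_i) dfix.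
  by rewrite (coef_map (Qt1_rmorphism)).
have [c cE] := fin_all_exists (fun i : 'I_(size d) => dconst i).
(* The default 0 is never reached, since [insub] succeeds below [size d]. *)
pose d' := \poly_(i < size d) (if insub i is Some j then c j else 0).
have Ed : d = map_poly constm d'.
  apply/polyP => i; rewrite coef_map coef_poly.
  case: ltnP => [id|/(nth_default 0) ->]; last exact: esym (rmorph0 constm).
  by rewrite (insubT (fun j => j < _)%N id); apply: (cE (Ordinal id)).
have [|x rx] := closed_rootP d' _.
  by rewrite -(size_map_poly constm) -Ed gtn_eqF // dirr.1.
exists x; rewrite eqp_sym; apply: dirr.2; first by rewrite size_XsubC.
by rewrite dvdp_XsubCl Ed fmorph_root.
Qed.

End FixedFactors.

(** * Constant poles and existence of a telescoper *)

Theorem theorem4p12 (k : closedFieldType) (char0 : [pchar k] =i pred0)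
  (q : k) (q_neq0 : q != 0) (hq : forall i : int, i != 0 -> q ^ i != 1)
  (* K, with iota, is an algebraic closure of k(t) *)
  (K : closedFieldType) (iota : {rmorphism ratfun k -> K})
  (K_alg : forall z : K, algebraicOver iota z)
  (f : ratfun2 k)
  (m : nat) (n : 'I_m -> nat) (alpha : 'I_m -> nat -> K) (beta : 'I_m -> K)
  (hf : frac_map (map_poly iota) f = pfrac n alpha beta)
  (n_gt0 : forall i, (0 < n i)%N)
  (alpha_neq0 : forall i, alpha i (n i) != 0)
  (beta_sep : forall i i', i != i' -> forall z : int, beta i - beta i' != z%:~R) :
  (exists L : {poly ratfun k}, L != 0 /\
     exists g : ratfun2 k, op_apply q L f = Deltax g)
  <-> (forall i, exists c : k, beta i = const_in iota c).
Proof.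
have betaI : injective beta.
  move=> i j ij; apply/eqP/negPn/negP => /beta_sep/(_ 0).
  by rewrite ij subrr eqxx.
have [a [b [b0 ab Ef]]] := frac_coprime f.
have [P [EP Pbeta]] := pfracE betaI n_gt0 alpha_neq0.
set D := pfrac_denom n beta in EP.
have D0 : D != 0 := pfrac_denom_neq0 n beta.
have bi0 : map_poly iota b != 0 by rewrite map_poly_eq0.
(* Two forms of [f] over [K] are compared. As [a], [b] are coprime and [P] vanishes at no [beta i],
   the roots of [b] are exactly the [beta i]. *)
have Eab : map_poly iota a * D = P * map_poly iota b.
  have := hf; rewrite EP Ef (frac_mapE (phi := map_poly iota)) //; last first.
    exact: map_poly_inj.
  by move/eqP; rewrite eqr_div ?tofrac_eq0 // -!tofracM tofrac_eq => /eqP.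
have bD : map_poly iota b %| D.
  rewrite -(@Gauss_dvdpr _ _ (map_poly iota a)) ?Eab ?dvdp_mull //.
  by rewrite coprimep_map coprimep_sym.
have broot i : root (map_poly iota b) (beta i).
  have : root (P * map_poly iota b) (beta i).
    rewrite -Eab rootM /D /pfrac_denom (bigD1 i) //= rootM -(prednK (n_gt0 i)).
    by rewrite root_exp_XsubC eqxx orbT.
  by rewrite rootM (negPf (Pbeta i)).
have rootb z : root (map_poly iota b) z -> exists i, z = beta i.
  case/dvdpP: bD => r Dr bz; apply: (@root_pfrac_denom _ _ n).
  by rewrite -/D Dr rootM bz orbT.
split=> [[L [L0 [g Lg]]] i|/fin_all_exists[c betaE]].
  (* A common root gives two of the [beta] differing by [z]: [beta_sep] excludes distinct indices,
     characteristic zero equal ones. *)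
  have bcop (z : int) : z != 0 -> coprimep b (shiftp z b).
    move=> z0; rewrite -(coprimep_map iota) coprimep_def; apply/negPn/closed_rootP.
    case=> x; rewrite root_gcd => /andP[/rootb[j xj]].
    rewrite map_comp_poly rmorphD /= map_polyX map_polyC /= rmorph_int.
    rewrite /root horner_comp !hornerE => /rootb[j' xj'].
    have Ez : beta j' - beta j = z%:~R by rewrite -xj -xj' addrC addKr.
    have [jj'|] := eqVneq j' j; last by move/beta_sep/(_ z)/eqP; apply.
    move/esym/eqP: Ez; rewrite jj' subrr intr_eq0_char0 ?(negPf z0) //.
    by move=> p; rewrite (fmorph_pchar iota) char0_ratfun.
  (* The minimal polynomial of [beta i] is fixed by Q_t, hence linear with a constant root. *)
  have [d [dirr dm db dz]] := irreducible_factor_root b0 (broot i).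
  have dfix : map_poly (Qt1 q) d = d.
    apply: (@telescoper_fixes_denominator _ (Qt1_rmorphism q_neq0)
      (char0_ratfun char0) _ L a b g) => //.
      by move=> j c z; apply: Qt1_int_shift.
    by rewrite -Ef.
  have [c dc] := irreducible_fixed q_neq0 hq dirr dfix.
  exists c; apply/eqP; move: dz.
  have -> : root (map_poly iota d) (beta i) =
      root (map_poly iota ('X - (constm k c)%:P)) (beta i).
    by apply: eqp_root; rewrite eqp_map.
  by rewrite rmorphB /= map_polyX map_polyC root_XsubC.
(* [E] descends [D] to k(t)[x]. Its factors are constant in t, so Q_t fixes it; [b] divides it
   because divisibility can be tested over [K]. *)
pose E : {poly ratfun k} := \prod_(i < m) ('X - (constm k (c i))%:P) ^+ n i.
have E0 : E != 0 by apply/prodf_neq0 => i _; rewrite expf_neq0 ?polyXsubC_eq0.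
have Efix : map_poly (Qt1_rmorphism q_neq0) E = E.
  rewrite rmorph_prod; apply: eq_bigr => i _.
  rewrite rmorphXn rmorphB /= (map_polyX (Qt1_rmorphism q_neq0)).
  rewrite (map_polyC (Qt1_rmorphism q_neq0)) /=.
  by rewrite Qt1_const.
have ED : map_poly iota E = D.
  rewrite rmorph_prod; apply: eq_bigr => i _.
  by rewrite rmorphXn rmorphB /= map_polyX map_polyC betaE.
have bE : b %| E by rewrite -(dvdp_map iota) ED.
(* Over the denominator [E], [f] is annihilated by some [L], so [g = 0] serves. *)
have [L L0 LE] := annihilator_exists (a * (E %/ b)) E0 Efix.
exists L; split=> //; exists 0.
have -> : Deltax 0 = 0 :> ratfun2 k.
  by rewrite /Deltax -[X in Sx X](subrr 0) Sx_is_zmod_morphism !subrr.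
rewrite -LE; have -> // : f = (a * (E %/ b))%:F / E%:F.
rewrite Ef; apply/eqP; rewrite eqr_div ?tofrac_eq0 // -!tofracM tofrac_eq.
by rewrite -mulrA divpK.
Qed.
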